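(* Let $\phi=e^{i\alpha}\tilde p/p$ be a normalized rational inner function of bidegree $(1,n)$, with $p(z_1,z_2)=p_1(z_2)+z_1p_2(z_2)$, and let $Q_\alpha$, $\psi^1_\alpha,\psi^2_\alpha$, $\Lambda^\flat$, $\Lambda^\sharp$ and the fiber maps $\phi_\lambda$ be as defined in the context. Suppose $Q_\alpha(\lambda)=0$ for some $\lambda\in\mathbb{T}\setminus(\Lambda^\flat\cup\Lambda^\sharp)$. Then $\psi^1_\alpha(\lambda)$ and $\psi^2_\alpha(\lambda)$ coincide as an element of $\mathbb{T}$, and $\phi_\lambda$ has a parabolic fixed point at $\psi^1_\alpha(\lambda)$.
   Context: $\mathbb{D}$ is the open unit disk and $\mathbb{T}$ the unit circle. For $p\in\mathbb{C}[z_1,z_2]$ of bidegree $(1,n)$ (degree $1$ in $z_1$ and $n$ in $z_2$) the reflection is $\tilde p(z_1,z_2)=z_1z_2^n\overline{p(1/\bar z_1,1/\bar z_2)}$. A normalized rational inner function of bidegree $(1,n)$ is $\phi=e^{i\alpha}\tilde p/p$ with $\alpha\in\mathbb{R}$, $p$ of bidegree $(1,n)$ without zeros in $\mathbb{D}^2$, and $p,\tilde p$ without common factors. Write $p(z)=p_1(z_2)+z_1p_2(z_2)$ with $p_1,p_2\in\mathbb{C}[z_2]$; then $\tilde p(z)=\tilde p_2(z_2)+z_1\tilde p_1(z_2)$, where $\tilde p_j(z_2)=z_2^n\overline{p_j(1/\bar z_2)}$. For $\lambda\in\mathbb{T}$, the fiber map is $\phi_\lambda(z_1)=\phi(z_1,\lambda)$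 (as a rational function of $z_1$, after cancellation of common factors); it is either a constant or a Möbius automorphism of $\mathbb{D}$. $\Lambda^\flat$ is the (finite) set of $\lambda\in\mathbb{T}$ for which $\phi_\lambda$ is constant, and $\Lambda^\sharp=\{z_2\in\mathbb{C}: p_2(z_2)=0\}$. Define $Q_\alpha(z_2)=(p_1(z_2)-e^{i\alpha}\tilde p_1(z_2))^2+4e^{i\alpha}p_2(z_2)\tilde p_2(z_2)$ and $$\psi^{1}_\alpha(z_2)=\frac{p_1(z_2)-e^{i\alpha}\tilde p_1(z_2)+\sqrt{Q_\alpha(z_2)}}{2p_2(z_2)},\qquad \psi^{2}_\alpha(z_2)=\frac{p_1(z_2)-e^{i\alpha}\tilde p_1(z_2)-\sqrt{Q_\alpha(z_2)}}{2p_2(z_2)}.$$ Up to sign conventions these are intended as the parametrizations of the roots in $z_1$ of $P_\alpha(z_1,z_2)=e^{i\alpha}\tilde p(z_1,z_2)-z_1p(z_1,z_2)$ for $p_2(z_2)\ne0$, i.e. of $z_1=\frac{-(p_1-e^{i\alpha}\tilde p_1)\pm\sqrt{Q_\alpha}}{2p_2}$; throughout, $\psi^{1}_\alpha,\psi^2_\alpha$ denote these roots, so the numerator term $p_1-e^{i\alpha}\tilde p_1$ above is to be read with a minus sign: $\psi^{1,2}_\alpha=\frac{1}{2p_2}\left(-(p_1-e^{i\alpha}\tilde p_1)\pm\sqrt{Q_\alpha}\right)$. A non-identity Möbius automorphism of $\mathbb{D}$ is parabolic if it has no fixed point in $\mathbb{D}$ and exactly one fixed point on $\mathbb{T}$;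 that point is then called a parabolic fixed point. *)

(* Defs.v *)
From HB Require Import structures.
From mathcomp Require Import all_boot all_order all_algebra.
From mathcomp Require Import complex.
From mathcomp Require Import all_classical all_reals all_analysis.

Set Implicit Arguments.
Unset Strict Implicit.
Unset Printing Implicit Defensive.

Import Order.TTheory GRing.Theory Num.Theory.

Local Open Scope classical_set_scope.
Local Open Scope complex_scope.
Local Open Scope ring_scope.

(* C[z_1, z_2] is represented by {poly {poly R[i]}}: the outer variable is z_1
   and the coefficients are polynomials in z_2.  Thus p.[z1, z2] of polyXY is
   p(z_1, z_2), and p = p_1 + z_1 p_2 has p_1 = p`_0 and p_2 = p`_1. *)

Section RationalInner.
Variable R : realType.
Local Notation C := R[i].

Definition unit_disk : set C := [set z | `|z| < 1].
Definition unit_circle : set C := [set z | `|z| = 1].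
Definition closed_unit_disk : set C := [set z | `|z| <= 1].

Definition expi (a : R) : C := cos a +i* sin a.

(* size and sizeY are the degrees plus one, so these degrees are exact. *)
Definition has_bidegree (m n : nat) (p : {poly {poly C}}) : Prop :=
  size p = m.+1 /\ sizeY p = n.+1.

(* z |-> z^n * conj (q (1 / conj z)), see reflect1E *)
Definition reflect1 (n : nat) (q : {poly C}) : {poly C} :=
  \poly_(j < n.+1) (q`_(n - j))^*.

(* (z_1, z_2) |-> z_1^m * z_2^n * conj (p (1 / conj z_1, 1 / conj z_2)),
   see reflect2E *)
Definition reflect2 (m n : nat) (p : {poly {poly C}}) : {poly {poly C}} :=
  \poly_(i < m.+1) reflect1 n p`_(m - i).

(* Stated through factorizations in C[z_1, z_2], because the divisibility of
   polydiv over a coefficient ring that is not a field is a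
   pseudo-divisibility. *)
Definition no_common_factor (p q : {poly {poly C}}) : Prop :=
  forall d a b : {poly {poly C}},
    p = d * a -> q = d * b -> d \is a GRing.unit.

(* exp(i alpha) * reflect2 1 n p / p is a normalized rational inner function of
   bidegree (1, n) for every real alpha. *)
Definition rif_denominator (n : nat) (p : {poly {poly C}}) : Prop :=
  [/\ has_bidegree 1 n p,
      forall z1 z2 : C, unit_disk z1 -> unit_disk z2 -> p.[z1, z2] != 0
    & no_common_factor p (reflect2 1 n p)].

Definition rif (n : nat) (alpha : R) (p : {poly {poly C}}) (z1 z2 : C) : C :=
  expi alpha * (reflect2 1 n p).[z1, z2] / p.[z1, z2].

Definition slice (lambda : C) (p : {poly {poly C}}) : {poly C} :=
  map_poly (horner_eval lambda) p.

(* phi_lambda is the quotient of the two slices divided by their gcd, so it is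
   defined also where p(., lambda) vanishes together with its reflection; at a
   genuine pole it has the junk value 0. *)
Definition fiber_map (n : nat) (alpha : R) (p : {poly {poly C}}) (lambda : C)
    (z1 : C) : C :=
  let u := expi alpha *: slice lambda (reflect2 1 n p) in
  let v := slice lambda p in
  let g := gcdp u v in
  (u %/ g).[z1] / (v %/ g).[z1].

Definition Lambda_flat (n : nat) (alpha : R) (p : {poly {poly C}}) : set C :=
  [set lambda | unit_circle lambda /\
    exists c : C, forall z1 : C, fiber_map n alpha p lambda z1 = c].

Definition Lambda_sharp (p : {poly {poly C}}) : set C :=
  [set z2 | (p`_1).[z2] = 0].

Definition Qpoly (n : nat) (alpha : R) (p : {poly {poly C}}) : {poly C} :=
  (p`_0 - expi alpha *: reflect1 n p`_0) ^+ 2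
  + (4%:R * expi alpha) *: (p`_1 * reflect1 n p`_1).

Definition psi1 (n : nat) (alpha : R) (p : {poly {poly C}}) (z2 : C) : C :=
  (- ((p`_0).[z2] - expi alpha * (reflect1 n p`_0).[z2])
   + sqrtC (Qpoly n alpha p).[z2]) / (2%:R * (p`_1).[z2]).

Definition psi2 (n : nat) (alpha : R) (p : {poly {poly C}}) (z2 : C) : C :=
  (- ((p`_0).[z2] - expi alpha * (reflect1 n p`_0).[z2])
   - sqrtC (Qpoly n alpha p).[z2]) / (2%:R * (p`_1).[z2]).

(* Only the values on the closed disk matter: there the denominator
   1 - conj a * z does not vanish. *)
Definition mobius_automorphism (f : C -> C) : Prop :=
  exists b a : C, [/\ unit_circle b, unit_disk a
    & forall z, closed_unit_disk z -> f z = b * ((z - a) / (1 - a^* * z))].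

Definition parabolic (f : C -> C) : Prop :=
  [/\ mobius_automorphism f,
      ~ (forall z, unit_disk z -> f z = z),
      ~ (exists z, unit_disk z /\ f z = z)
    & exists! z, unit_circle z /\ f z = z].

Definition parabolic_fixed_point (f : C -> C) (tau : C) : Prop :=
  [/\ parabolic f, unit_circle tau & f tau = tau].

Lemma reflect1E (n : nat) (q : {poly C}) (z : C) :
  (size q <= n.+1)%N -> z != 0 ->
  (reflect1 n q).[z] = z ^+ n * (q.[(z^*)^-1])^*.
Proof.
move=> sq z0; rewrite horner_poly (horner_coef_wide _ sq) rmorph_sum mulr_sumr.
rewrite (reindex_inj rev_ord_inj) /=; apply: eq_bigr => -[j /= jn] _.
rewrite subSS subKn // rmorphM rmorphXn fmorphV /= conjCK mulrCA; congr (_ * _).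
by rewrite exprVn -expfB_cond // (negPf z0).
Qed.

Lemma reflect2E (m n : nat) (p : {poly {poly C}}) (z1 z2 : C) :
  (size p <= m.+1)%N -> (sizeY p <= n.+1)%N -> z1 != 0 -> z2 != 0 ->
  (reflect2 m n p).[z1, z2] =
  z1 ^+ m * z2 ^+ n * (p.[(z1^*)^-1, (z2^*)^-1])^*.
Proof.
move=> sp sYp z10 z20.
rewrite horner_poly (horner_coef_wide _ sp) !horner_sum rmorph_sum mulr_sumr.
rewrite (reindex_inj rev_ord_inj) /=; apply: eq_bigr => -[i /= im] _.
rewrite subSS subKn // !hornerM -!polyC_exp !hornerC reflect1E //; last first.
  exact: leq_trans (max_size_coefXY _ _) sYp.
rewrite rmorphM rmorphXn fmorphV /= conjCK.
have -> : z1 ^+ (m - i) = z1 ^+ m * z1^-1 ^+ i.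
  by rewrite exprVn -expfB_cond // (negPf z10).
by rewrite mulrC mulrACA [X in _ * X]mulrC.
Qed.

Lemma fiber_mapE (n : nat) (alpha : R) (p : {poly {poly C}}) (lambda z1 : C) :
  p.[z1, lambda] != 0 ->
  fiber_map n alpha p lambda z1 = rif n alpha p z1 lambda.
Proof.
have sliceE q : (slice lambda q).[z1] = q.[z1, lambda].
  by rewrite /slice -{1}(hornerC z1 lambda) horner_map.
rewrite /fiber_map /rif -!sliceE -hornerZ.
set u := _ *: _; set v := slice _ p => v0.
have := divpK (dvdp_gcdl u v); have := divpK (dvdp_gcdr u v).
set g := gcdp u v => Ev Eu.
have g0 : g.[z1] != 0.
  by apply: contraNneq v0 => g0; rewrite -Ev hornerM g0 mulr0.
by rewrite -{2}Eu -{2}Ev !hornerM -mulf_div divff // mulr1.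
Qed.

End RationalInner.

Arguments unit_disk {R}.
Arguments unit_circle {R}.
Arguments closed_unit_disk {R}.

(* Main.v *)
Require Import Defs.
From mathcomp Require Import all_boot all_order all_algebra.
From mathcomp Require Import complex ring.
From mathcomp Require Import all_classical all_reals all_analysis.

(** Fix [lambda] on the circle and put [a = p_1(lambda)], [b = p_2(lambda)],
    [w = e^(i alpha) lambda^n].  On the circle the reflection of [p_j] takes
    the value [lambda^n conj (p_j(lambda))], so with [|w| = 1]
      [phi_lambda(z) = w (conj a * z + conj b) / (a + b z)],
      [Q_alpha(lambda) = (a - w conj a)^2 + 4 w |b|^2],
    and [Q_alpha(lambda)] is the discriminant of the fixed point equation
    [b z^2 + (a - w conj a) z - w conj b = 0] of [phi_lambda].

    If the discriminant vanishes, then [|a - w conj a| = 2 |b|].  Hence the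
    double root [tau = - (a - w conj a) / (2 b)], which is the common value of
    [psi1] and [psi2], has modulus one ([double_root_norm]), and the triangle
    inequality gives [|b| <= |a|] ([discr0_norm_le]).  The case [|a| = |b|] is
    that of a constant fiber map ([flat_fiber]), so [|b| < |a|] off the flat
    set.  Then [phi_lambda] is an automorphism of the disk, and [tau] is its
    only fixed point in the closed disk ([parabolic_linear_fractional]). *)

Import Order.TTheory GRing.Theory Num.Theory.

Local Open Scope classical_set_scope.
Local Open Scope ring_scope.

(** * The fixed point equation of a linear fractional map *)

Section DoubleFixedPoint.
Set Implicit Arguments.
Unset Strict Implicit.
Variable C : numClosedFieldType.
Implicit Types a b w z : C.

Definition double_root a b w : C := - (a - w * a^* ) / (2%:R * b).

(** A vanishing discriminant is an identity between [(a - w a^* )^2] and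
    [- 4 w |b|^2], and taking moduli removes the unimodular factor [- w]. *)
Lemma discr0_norm a b w : `|w| = 1 ->
  (a - w * a^* ) ^+ 2 + 4%:R * w * (b * b^* ) = 0 ->
  `|a - w * a^*| = 2%:R * `|b|.
Proof.
move=> w1 /(canRL (addrK _)); rewrite sub0r => E.
apply/eqP; rewrite -(@eqrXn2 _ 2) ?mulr_ge0 ?normr_ge0 ?ler0n //.
rewrite -normrX E normrN !normrM w1 norm_conjC normr_nat; apply/eqP; ring.
Qed.

Lemma discr0_norm_le a b w : `|w| = 1 ->
  (a - w * a^* ) ^+ 2 + 4%:R * w * (b * b^* ) = 0 -> `|b| <= `|a|.
Proof.
move=> w1 /(discr0_norm w1) E.
rewrite -(ler_pM2l (ltr0n C 2)) -E (le_trans (ler_normB _ _)) //.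
by rewrite normrM w1 mul1r norm_conjC mulr_natl mulr2n.
Qed.

Lemma double_root_norm a b w : `|w| = 1 -> b != 0 ->
  (a - w * a^* ) ^+ 2 + 4%:R * w * (b * b^* ) = 0 ->
  `|double_root a b w| = 1.
Proof.
move=> w1 b0 /(discr0_norm w1) E.
by rewrite normf_div normrN E normrM normr_nat divff // mulf_neq0 ?pnatr_eq0
  ?normr_eq0.
Qed.

(** Clearing the denominator turns the fixed point equation into a quadratic
    one, which is [b (z - double_root a b w)^2 = 0] when its discriminant
    vanishes. *)
Lemma double_root_fixed a b w z : b != 0 -> a + b * z != 0 ->
  (a - w * a^* ) ^+ 2 + 4%:R * w * (b * b^* ) = 0 ->
  w * (a^* * z + b^* ) / (a + b * z) = z <-> z = double_root a b w.
Proof.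
move=> b0 v0 Q0.
have factor : z * (a + b * z) - w * (a^* * z + b^* )
    = b * (z - double_root a b w) ^+ 2.
  (* Completing the square leaves the discriminant divided by [4 b]. *)
  suff <- : z * (a + b * z) - w * (a^* * z + b^* )
      + ((a - w * a^* ) ^+ 2 + 4%:R * w * (b * b^* )) / (4%:R * b)
      = b * (z - double_root a b w) ^+ 2 by rewrite Q0 mul0r addr0.
  by rewrite /double_root; field.
split=> [/(canRL (divfK v0)) E | E].
  apply/eqP; rewrite -subr_eq0 -sqrf_eq0.
  by move/eqP: factor; rewrite -E subrr eq_sym mulf_eq0 (negPf b0).
apply: (canLR (mulfK v0)); apply/eqP; rewrite eq_sym -subr_eq0 factor -E.
by rewrite subrr expr0n mulr0.
Qed.

Lemma denominator_neq0 a b z : `|b| < `|a| -> `|z| <= 1 -> a + b * z != 0.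
Proof.
move=> ba z1; apply: contraTneq ba => /eqP; rewrite addr_eq0 => /eqP ->.
by rewrite normrN normrM -real_leNgt ?realM ?normr_real // ler_piMr.
Qed.

End DoubleFixedPoint.

(** * Parabolic linear fractional maps *)

Section Fibers.
Set Implicit Arguments.
Unset Strict Implicit.
Variable R : realType.
Local Notation C := R[i].
Implicit Types (a b w z lambda : C) (f : C -> C).

(** For [|b| < |a|] the map is the Blaschke factor of [- (b / a)^* ] times the
    unimodular constant [w a^* / a]. Its fixed points in the closed disk reduce
    to the double root, which lies on the circle, so none is left inside; in
    particular the map is not the identity. The formula for [f] is asked only on
    the closed disk, because a fiber map takes a default value at its pole. *)
Lemma parabolic_linear_fractional a b w f :
  `|w| = 1 -> b != 0 -> `|b| < `|a| ->
  (a - w * a^* ) ^+ 2 + 4%:R * w * (b * b^* ) = 0 ->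
  (forall z, `|z| <= 1 -> f z = w * (a^* * z + b^* ) / (a + b * z)) ->
  parabolic_fixed_point f (double_root a b w).
Proof.
move=> w1 b0 ba Q0 fE; have tau1 := double_root_norm w1 b0 Q0.
have a0 : a != 0 by rewrite -normr_gt0 (le_lt_trans _ ba).
have fixE z : `|z| <= 1 -> f z = z <-> z = double_root a b w.
  by move=> z1; rewrite fE //; apply: double_root_fixed => //;
    exact: denominator_neq0.
have diskNfix z : `|z| < 1 -> f z <> z.
  by move=> z1 /(fixE z (ltW z1)) zE; rewrite zE tau1 ltxx in z1.
split=> //; last by apply/fixE; rewrite ?tau1.
split.
- exists (w * a^* / a), (- (b / a)^* ); split.
  + by rewrite /unit_circle /= !normrM w1 mul1r normfV norm_conjC divff
      ?normr_eq0.
  + rewrite /unit_disk /= normrN norm_conjC normf_div ltr_pdivrMr ?normr_gt0 //.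
    by rewrite mul1r.
  + move=> z z1; rewrite fE // rmorphN /= conjCK fmorph_div /=.
    have v0 := denominator_neq0 ba z1.
    by field; rewrite a0 mulNr opprK v0 conjC_eq0 a0.
- by move=> /(_ 0); rewrite /unit_disk /= normr0 => /(_ ltr01); apply: diskNfix;
    rewrite normr0.
- by case=> z [z1 fz]; exact: diskNfix z1 fz.
- exists (double_root a b w); split.
    by split=> //; apply/fixE; rewrite ?tau1.
  by move=> z [z1 fz]; apply/esym/fixE; rewrite ?z1.
Qed.

(** * Fibers of a rational inner function *)

Lemma norm_expi (t : R) : `|expi t| = 1.
Proof. by rewrite /expi normc_def /= cos2Dsin2 sqrtr1. Qed.

Lemma reflect1_circle n (q : {poly C}) lambda :
  (size q <= n.+1)%N -> `|lambda| = 1 ->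
  (reflect1 n q).[lambda] = lambda ^+ n * (q.[lambda])^*.
Proof.
move=> sq l1; have l0 : lambda != 0 by rewrite -normr_eq0 l1 oner_eq0.
rewrite reflect1E //; congr (_ * (q.[_])^* ).
by rewrite invC_norm norm_conjC l1 expr1n invr1 mul1r conjCK.
Qed.

Lemma coef_slice lambda (q : {poly {poly C}}) i :
  (slice lambda q)`_i = (q`_i).[lambda].
Proof. by rewrite coef_map. Qed.

(** When the two slices are proportional, the common factor removed by the gcd
    is all of [p(., lambda)] up to a constant, so the quotient takes the value
    [c] even at the zero of [p(., lambda)]. *)
Lemma fiber_map_proportional n alpha (p : {poly {poly C}}) lambda (c : C) :
  slice lambda p != 0 -> c != 0 ->
  expi alpha *: slice lambda (reflect2 1 n p) = c *: slice lambda p ->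
  forall z, fiber_map n alpha p lambda z = c.
Proof.
move=> v0 c0 E z; rewrite /fiber_map E; set v := slice _ _ in v0 *.
set g := gcdp _ _.
have gv : g %= v.
  by have := eqp_gcdl v (eqp_scale v c0); rewrite gcdpp.
have g0 : g != 0 by rewrite gcdp_eq0 negb_and v0 orbT.
have /size_poly1P[d d0 dE] : size (v %/ g) == 1%N.
  by rewrite size_divp // (eqp_size gv) (polySpred v0) /= subSnn.
by rewrite divpZl hornerZ dE hornerC mulfK.
Qed.

(** The slices [a + b z] and [w (b^* + a^* z)] have determinant
    [w (|a|^2 - |b|^2)], so they are proportional when [|a| = |b|]. *)
Lemma flat_fiber n alpha (p : {poly {poly C}}) lambda :
  has_bidegree 1 n p -> unit_circle lambda -> (p`_1).[lambda] != 0 ->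
  `|(p`_0).[lambda]| = `|(p`_1).[lambda]| -> Lambda_flat n alpha p lambda.
Proof.
move=> [sp spY] l1 b0 ab; split=> //.
have sq i : (size (p`_i)%R <= n.+1)%N by rewrite -spY max_size_coefXY.
have l0 : lambda != 0 by rewrite -normr_eq0 l1 oner_eq0.
have e0 : expi alpha != 0 by rewrite -normr_eq0 norm_expi oner_eq0.
have a0 : (p`_0).[lambda] != 0 by rewrite -normr_eq0 ab normr_eq0.
set a := (p`_0).[lambda] in ab a0; set b := (p`_1).[lambda] in ab b0.
exists (expi alpha * lambda ^+ n * b^* / a); apply: fiber_map_proportional.
- by apply: contraNneq b0 => /(congr1 (fun q : {poly C} => q`_1));
    rewrite coef_slice coef0 => /eqP.
- by rewrite !mulf_neq0 ?invr_eq0 ?expf_neq0 ?conjC_eq0.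
- apply/polyP=> -[|[|i]]; rewrite !coefZ !coef_slice coef_poly /=.
  + by rewrite reflect1_circle // -/b -/a divfK // mulrA.
  + rewrite reflect1_circle // -/b -/a.
    have aa : a * a^* = b * b^* by rewrite -!normCK ab.
    have -> : a^* = b * b^* / a by rewrite -aa mulrAC divff // mul1r.
    by field.
  + by rewrite nth_default ?sp // !horner0 !mulr0.
Qed.

Lemma fiber_map_linear_fractional n alpha (p : {poly {poly C}}) lambda z :
  has_bidegree 1 n p -> `|lambda| = 1 ->
  (p`_0).[lambda] + (p`_1).[lambda] * z != 0 ->
  fiber_map n alpha p lambda z =
  expi alpha * lambda ^+ n * (((p`_0).[lambda])^* * z + ((p`_1).[lambda])^* )
    / ((p`_0).[lambda] + (p`_1).[lambda] * z).
Proof.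
move=> [sp spY] l1.
have sq i : (size (p`_i)%R <= n.+1)%N by rewrite -spY max_size_coefXY.
have pE : p.[z, lambda] = (p`_0).[lambda] + (p`_1).[lambda] * z.
  rewrite (horner_coef p) sp !big_ord_recl big_ord0 addr0 /= expr0 mulr1 expr1.
  by rewrite !hornerE.
rewrite -pE => v0; rewrite fiber_mapE // /rif; congr (_ / _).
rewrite horner_poly !big_ord_recl big_ord0 addr0 /= expr0 mulr1 expr1.
by rewrite hornerD hornerM hornerC !reflect1_circle //; ring.
Qed.

End Fibers.

Theorem theorem4p7 (R : realType) (n : nat) (alpha : R)
    (p : {poly {poly R[i]}}) (lambda : R[i]) :
  rif_denominator n p ->
  (unit_circle `\` (Lambda_flat n alpha p `|` Lambda_sharp p)) lambda ->
  (Qpoly n alpha p).[lambda] = 0 ->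
  [/\ psi1 n alpha p lambda = psi2 n alpha p lambda,
      unit_circle (psi1 n alpha p lambda)
    & parabolic_fixed_point (fiber_map n alpha p lambda)
        (psi1 n alpha p lambda)].
Proof.
move=> [bideg _ _] [l1 /not_orP[Nflat /eqP b0]] Q0.
have sq i : (size (p`_i)%R <= n.+1)%N by rewrite -bideg.2 max_size_coefXY.
set a := (p`_0).[lambda]; set b := (p`_1).[lambda] in b0.
pose w := expi alpha * lambda ^+ n.
have w1 : `|w| = 1 by rewrite normrM norm_expi normrX l1 expr1n mulr1.
have discr0 : (a - w * a^* ) ^+ 2 + 4%:R * w * (b * b^* ) = 0.
  rewrite -Q0 !(hornerD, hornerN, hornerZ, hornerM, horner_exp).
  by rewrite !reflect1_circle // -/a -/b /w; ring.
have psiE : psi1 n alpha p lambda = double_root a b w.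
  by rewrite /psi1 Q0 sqrtC0 addr0 reflect1_circle // mulrA.
have ba : `|b| < `|a|.
  rewrite lt_def (discr0_norm_le w1 discr0) andbT.
  by apply/eqP => ab; apply: Nflat; exact: flat_fiber.
rewrite psiE; split.
- by rewrite -psiE /psi1 /psi2 Q0 sqrtC0 subr0 addr0.
- exact: double_root_norm.
- apply: parabolic_linear_fractional => // z z1.
  by apply: fiber_map_linear_fractional => //; exact: denominator_neq0.
Qed.
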